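(* Let $q$ be a prime power, $m\ge n\ge2$ integers, and let $k$ and $d$ be integers with $1\le k\le n$, $2\le d\le n$ and $d+k-2\le n$. Let $\mathcal{F}$ be the family of $k$-dimensional $\mathbb{F}_{q^m}$-linear codes in $\mathbb{F}_{q^m}^n$, and let $\mathcal{F}':=\{\mathcal{C}\in\mathcal{F}\mid d^{\mathrm{rk}}(\mathcal{C})<d\}$, where $d^{\mathrm{rk}}(\mathcal{C})$ is the minimum rank distance. Then $$\left[\begin{matrix} n \\ k \end{matrix}\right]_{q^m}^{-1}\Lambda(q^m;n,d-1,k)\le\frac{|\mathcal{F}'|}{|\mathcal{F}|}\le\frac{q^{mk}-1}{(q^m-1)(q^{mn}-1)}\left(\boldsymbol{b}^{\mathrm{rk}}(d-1)-1\right).$$ In particular, with $q,n,k,d$ fixed, $$\frac{|\mathcal{F}'|}{|\mathcal{F}|}\in\Theta\left(q^{m(d+k-2-n)}\right)\text{ as }m\to+\infty.$$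
   Context: The rank weight of $x\in\mathbb{F}_{q^m}^n$ is the $\mathbb{F}_q$-dimension of the $\mathbb{F}_q$-span of its components; the rank distance between $x$ and $y$ is the rank weight of $x-y$; the minimum rank distance of a non-zero linear code is the minimum rank weight of its non-zero elements. The size of a ball of radius $r$ for the rank distance in $\mathbb{F}_{q^m}^n$ is $\boldsymbol{b}^{\mathrm{rk}}(r)=\sum_{i=0}^r\left[\begin{matrix} n \\ i \end{matrix}\right]_q\prod_{j=0}^{i-1}(q^m-q^j)$. $\left[\begin{matrix} a \\ b \end{matrix}\right]_Q$ is the $Q$-binomial coefficient (number of $b$-dimensional subspaces of $\mathbb{F}_Q^a$; zero if $b<0$ or $b>a$). For non-negative integers $N,t,k$ and a prime power $Q$, $$\Lambda(Q;N,t,k):=\sum_{h=1}^t\left[\begin{matrix} t \\ h \end{matrix}\right]_Q\sum_{s=h}^t\left[\begin{matrix} t-h \\ s-h \end{matrix}\right]_Q\left[\begin{matrix} N-s \\ N-k \end{matrix}\right]_Q(-1)^{s-h}Q^{\binom{s-h}{2}}.$$ For real functions $f,g$ on an infinite set $S\subseteq\mathbb{N}$, $g\in\Theta(f)$ means there exist real $C_1,C_2>0$ and $s_0\in S$ with $0\le C_1f(s)\le g(s)\le C_2f(s)$ for all $s\in S$, $s\ge s_0$. *)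

(* Defs.v *)
From HB Require Import structures.
From mathcomp Require Import all_boot all_order all_algebra all_field.
From mathcomp Require Import reals.

Set Implicit Arguments.
Unset Strict Implicit.
Unset Printing Implicit Defensive.

Import Order.TTheory GRing.Theory Num.Theory.
Local Open Scope ring_scope.

(* Subspaces are stored as canonical generating matrices, so there are finitely
   many of them over a finite field. *)
Import VectorInternalTheory.
HB.instance Definition _ (K : finFieldType) (vT : vectType K) :=
  [Countable of {vspace vT} by <:].
HB.instance Definition _ (K : finFieldType) (vT : vectType K) :=
  [Finite of {vspace vT} by <:].

(* [a, b]_Q with Q = #|K|.  The arguments are integers because N - s and N - k
   may be negative in Lambda, and the coefficient is then zero. *)
Definition qbinom (K : finFieldType) (a b : int) : nat :=
  match a, b with
  | Posz a', Posz b' => #|[set V : {vspace 'rV[K]_a'} | \dim V == b']|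
  | _, _ => 0%N
  end.

(* Lambda(#|K|; N, t, k) *)
Definition Lambda (K : finFieldType) (N t k : nat) : int :=
  \sum_(1 <= h < t.+1) (qbinom K t h)%:Z *
    \sum_(h <= s < t.+1)
      (qbinom K (t%:Z - h%:Z) (s%:Z - h%:Z))%:Z *
      (qbinom K (N%:Z - s%:Z) (N%:Z - k%:Z))%:Z *
      (-1) ^+ (s - h) * (#|K|%:Z) ^+ 'C(s - h, 2).

(* b^rk(r), the size of a ball of radius r for the rank distance in
   F_{q^m}^n, where q = #|F|. *)
Definition rk_ball_size (F : finFieldType) (m n r : nat) : int :=
  \sum_(0 <= i < r.+1)
    (qbinom F n i)%:Z *
    \prod_(0 <= j < i) ((#|F|%:Z) ^+ m - (#|F|%:Z) ^+ j).

Definition rk_weight (F : finFieldType) (L : fieldExtType F) (n : nat)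
    (x : 'rV[L]_n) : nat :=
  \dim <<[seq x ord0 i | i : 'I_n]>>%VS.

(* [finvect_type L] is L with its canonical finite field structure.
   Rank weights are at most n, so on a non-zero code the neutral element n does
   not affect the minimum. *)
Definition rk_min_dist (F : finFieldType) (L : fieldExtType F) (n : nat)
    (C : {vspace 'rV[finvect_type L]_n}) : nat :=
  \big[minn/n]_(x : 'rV[finvect_type L]_n | (x \in C) && (x != 0)) rk_weight x.

Definition codes (F : finFieldType) (L : fieldExtType F) (n k : nat) :
    {set {vspace 'rV[finvect_type L]_n}} :=
  [set C | \dim C == k].

Definition bad_codes (F : finFieldType) (L : fieldExtType F) (n k d : nat) :
    {set {vspace 'rV[finvect_type L]_n}} :=
  [set C in codes L n k | (rk_min_dist C < d)%N].

Definition bad_density (R : realType) (F : finFieldType) (L : fieldExtType F)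
    (n k d : nat) : R :=
  #|bad_codes L n k d|%:R / #|codes L n k|%:R.

(* g \in Theta(f), for functions on the set S of naturals; values outside S are
   irrelevant. *)
Definition Theta (R : realType) (S : pred nat) (f g : nat -> R) : Prop :=
  exists C1 C2 : R, exists s0 : nat,
    [/\ 0 < C1, 0 < C2, S s0 &
      forall s : nat, S s -> (s0 <= s)%N ->
        [/\ 0 <= C1 * f s, C1 * f s <= g s & g s <= C2 * f s]].

(* Main.v *)
(* Write Q = q^m and t = d - 1.

   Lower bound: the vectors supported on t fixed coordinates form a
   t-dimensional code U, all of whose elements have rank weight at most t, so
   every code meeting U non-trivially is bad.  Moebius inversion in the lattice
   of subspaces shows that Lambda counts exactly the k-dimensional codes
   meeting a given t-dimensional one.

   Upper bound: a bad code contains at least Q - 1 non-zero vectors of rank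
   weight at most t, and each non-zero vector lies in [n-1, k-1]_Q codes; one
   concludes by [n, k]_Q (Q^k - 1) = (Q^n - 1) [n-1, k-1]_Q.

   For the asymptotics, [n, k]_Q <= 2^k Q^(k(n-k)), and b^rk(t) is at most a
   constant times Q^t.  In the other direction, pairs (x, X) with x in U \ 0
   and X a (k-1)-tuple linearly independent modulo U (which exist because
   t + k - 1 <= n) span codes C with C cap U = <x>, and each such code comes
   from at most Q^(1 + k(k-1)) pairs. *)
Require Import Defs.
From HB Require Import structures.
From mathcomp Require Import all_boot all_order all_algebra all_field.
From mathcomp Require Import reals zify ring.

Set Implicit Arguments.
Unset Strict Implicit.
Unset Printing Implicit Defensive.

Import Order.TTheory GRing.Theory Num.Theory.
Local Open Scope ring_scope.

(** * Gaussian binomial coefficients *)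

(** Pascal's recursion makes sense for every natural [Q], so the identities below are pure
    arithmetic; [card_vspace_interval] and [qbinom_gauss] link it to subspaces. *)
Fixpoint gauss (Q n k : nat) {struct n} : nat :=
  match n, k with
  | _, 0%N => 1%N
  | 0%N, _.+1 => 0%N
  | n'.+1, k'.+1 => (Q ^ k'.+1 * gauss Q n' k'.+1 + gauss Q n' k')%N
  end.

(** The Gaussian factorial without its denominators [(Q - 1) ^ n], which cancel in the product
    formula. *)
Definition qfact (Q n : nat) : nat := (\prod_(i < n) (Q ^ i.+1 - 1))%N.

Lemma gauss0 Q n : gauss Q n 0 = 1%N.
Proof. by case: n. Qed.

Lemma gaussS Q n k :
  gauss Q n.+1 k.+1 = (Q ^ k.+1 * gauss Q n k.+1 + gauss Q n k)%N.
Proof. by []. Qed.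

Lemma gauss_gt0 Q n k : (k <= n)%N -> (0 < gauss Q n k)%N.
Proof.
elim: n k => [|n IHn] [|k] // le_kn.
by rewrite gaussS addn_gt0 (IHn k) ?orbT.
Qed.

Lemma gauss_small Q n k : (n < k)%N -> gauss Q n k = 0%N.
Proof.
elim: n k => [|n IHn] [|k] //=; rewrite ltnS => lt_nk.
by rewrite !IHn ?muln0 // ltnW.
Qed.

Lemma gaussnn Q n : gauss Q n n = 1%N.
Proof. by elim: n => //= n ->; rewrite gauss_small ?muln0. Qed.

Lemma qfactS Q n : qfact Q n.+1 = (qfact Q n * (Q ^ n.+1 - 1))%N.
Proof. by rewrite /qfact big_ord_recr. Qed.

Section GaussianBinomials.
Variables (Q : nat) (Q_gt1 : (1 < Q)%N).

Lemma qfact_gt0 n : (0 < qfact Q n)%N.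
Proof.
by apply: prodn_gt0 => i; rewrite subn_gt0 -(expn0 Q) ltn_exp2l.
Qed.

(** Pascal's rule leads from (a+1, b+1) to (a+1, b) and (a, b+1), hence the induction on a bound for
    a + b. The terms recombine by Q^(a+b+2) - 1 = Q^(a+1) (Q^(b+1) - 1) + (Q^(a+1) - 1). *)
Lemma gauss_fact a b :
  (gauss Q (a + b) a * (qfact Q a * qfact Q b))%N = qfact Q (a + b).
Proof.
move: {2}(a + b)%N (leqnn (a + b)) => N; elim: N a b => [|N IHN] [|a] [|b].
all: rewrite ?addn0 ?gauss0 ?gaussnn /qfact ?big_ord0 ?mul1n ?muln1 //.
rewrite -!/(qfact _ _) addSn addnS ltnS => le_abN.
have := IHN a.+1 b; have := IHN a b.+1.
rewrite addnS addSn => /(_ le_abN) E1 /(_ le_abN) E2.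
have P1 : (0 < Q ^ a.+1)%N by rewrite expn_gt0 ltnW.
have P2 : (0 < Q ^ b.+1)%N by rewrite expn_gt0 ltnW.
have := expnD Q a.+1 b.+1; rewrite addSn addnS => E3.
rewrite gaussS qfactS (qfactS _ b) (qfactS _ (a + b).+1) E3.
move: E1 E2; rewrite !(qfactS Q a) (qfactS Q b).
move: (gauss _ _ _) (gauss _ _ _) (qfact _ _) (qfact _ _) (qfact _ _) P1 P2.
move: (Q ^ a.+1)%N (Q ^ b.+1)%N => [|x] [|y] g1 g2 A B T // _ _.
have -> : (x.+1 * y.+1 - 1 = x.+1 * y + x)%N by rewrite mulnS; lia.
rewrite !subSS !subn0 mulnDr => E1 E2.
by rewrite -[in X in (_ = _ + X)%N]E1 -E2; ring.
Qed.

Lemma gauss_sym a b : gauss Q (a + b) a = gauss Q (a + b) b.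
Proof.
have qf_gt0 : (0 < qfact Q a * qfact Q b)%N by rewrite muln_gt0 !qfact_gt0.
apply/eqP; rewrite -(eqn_pmul2r qf_gt0) gauss_fact addnC.
by rewrite [(qfact Q a * _)%N]mulnC gauss_fact.
Qed.

Lemma gauss_sub n k : (k <= n)%N -> gauss Q n (n - k) = gauss Q n k.
Proof. by move=> /subnKC; move: (n - k)%N => b <-; rewrite gauss_sym. Qed.

(** For a prime power, both sides count pairs of a (k+1)-dimensional subspace and a non-zero vector
    in it. The counting of subspaces will rest on this identity, so it is derived from the product
    formula. *)
Lemma gauss_absorb n k :
  (gauss Q n.+1 k.+1 * (Q ^ k.+1 - 1))%N = ((Q ^ n.+1 - 1) * gauss Q n k)%N.
Proof.
have [lt_nk|/subnKC] := ltnP n k; first by rewrite !gauss_small ?muln0.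
move: (n - k)%N => b <-; apply/eqP.
rewrite -(eqn_pmul2r (m := qfact Q k * qfact Q b)); last first.
  by rewrite muln_gt0 !qfact_gt0.
rewrite -!mulnA gauss_fact [X in _ == X]mulnC -qfactS -addSn -gauss_fact qfactS.
by apply/eqP; ring.
Qed.

(** Two ways of counting flags of subspaces of dimensions h and s in a t-dimensional space. *)
Lemma gauss_mul t s h : (h <= s <= t)%N ->
  (gauss Q t h * gauss Q (t - h) (s - h))%N = (gauss Q t s * gauss Q s h)%N.
Proof.
case/andP => /subnKC; move: (s - h)%N => b <- /subnKC.
move: (t - (h + b))%N => c <-; rewrite -addnA addKn; apply/eqP.
rewrite -(eqn_pmul2r (m := qfact Q h * qfact Q b * qfact Q c)); last first.
  by rewrite !muln_gt0 !qfact_gt0.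
have E1 := gauss_fact h (b + c); have E2 := gauss_fact b c.
have E3 := gauss_fact (h + b) c; have E4 := gauss_fact h b.
apply/eqP; transitivity (qfact Q (h + (b + c))); first by rewrite -E1 -E2; ring.
by rewrite addnA -E3 -E4; ring.
Qed.

(** With a(i) = (-1)^i Q^C(i,2) one has a(i+1) = - a(i) Q^i, so Pascal's rule makes the sum
    telescope. This is the vanishing behind Moebius inversion. *)
Lemma gauss_alternating w :
  \sum_(0 <= i < w.+1) (-1) ^+ i * Q%:Z ^+ 'C(i, 2) * (gauss Q w i)%:Z
  = (w == 0%N)%:R.
Proof.
case: w => [|w]; first by rewrite big_nat1 expr0 !mul1r.
pose a i : int := (-1) ^+ i * Q%:Z ^+ 'C(i, 2).
have aS i : a i.+1 = - (a i * Q%:Z ^+ i).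
  by rewrite /a binS bin1 exprD exprS; ring.
rewrite big_nat_recl // gauss0 expr0 !mul1r.
rewrite (eq_bigr (fun i => - (a i.+2 * (gauss Q w i.+1)%:Z
                              - a i.+1 * (gauss Q w i)%:Z))); last first.
  move=> i _; rewrite -/(a i.+1) (aS i.+1) gaussS PoszD PoszM -natz natrX natz; ring.
rewrite sumrN telescope_sumr // (@gauss_small Q w w.+1) // gauss0 mulr0 sub0r opprK.
by rewrite /a /= expr1 expr0; ring.
Qed.

(** Each use of [gauss_absorb] divides by Q^(k+1) - 1, which is at least half of Q^(k+1); this costs
    one factor 2 per step. *)
Lemma gauss_le n k : (k <= n)%N -> (gauss Q n k <= 2 ^ k * Q ^ (k * (n - k)))%N.
Proof.
elim: k n => [|k IHk] [|n] // le_kn.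
have P1 : (0 < Q ^ k.+1)%N by rewrite expn_gt0 ltnW.
have Q2 : (2 <= Q ^ k.+1)%N by rewrite -(expn0 Q) ltn_exp2l.
have lt1 : (Q ^ k.+1 <= 2 * (Q ^ k.+1 - 1))%N by lia.
rewrite -(leq_pmul2r P1); apply: leq_trans (leq_mul (leqnn _) lt1) _.
rewrite mulnCA gauss_absorb subSS.
have le1 : ((Q ^ n.+1 - 1) * gauss Q n k <= Q ^ n.+1 * (2 ^ k * Q ^ (k * (n - k))))%N.
  by apply: leq_mul; rewrite ?leq_subr ?IHk.
apply: leq_trans (leq_mul (leqnn 2) le1) _.
rewrite (expnS 2 k) -!mulnA leq_mul2l /= mulnCA leq_mul2l -!expnD expn_eq0 /=.
by rewrite leq_exp2l // mulSn; move: (k * (n - k))%N => e; lia.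
Qed.
End GaussianBinomials.

(** * Counting subspaces and tuples *)

Section CountingSubspaces.
Variables (K : finFieldType) (T : finType) (cvT : Vector K T).
Let vT : vectType K := Vector.Pack cvT.
Implicit Types (S C W : {vspace vT}).
Local Notation Q := #|K|.

Lemma card_vspaceB S W : (S <= W)%VS ->
  #|[pred x : T | (x \in W) && (x \notin S)]| = (Q ^ \dim W - Q ^ \dim S)%N.
Proof.
move=> sSW; rewrite -!card_vspace.
rewrite -(cardID [pred x : T | x \in S] [pred x : T | x \in W]).
rewrite [X in (X + _)%N](_ : _ = #|[pred x : T | x \in S]|); last first.
  apply: eq_card => x; rewrite !inE.
  by apply: andb_idl => /(subvP sSW).
by rewrite addKn; apply: eq_card => x; rewrite !inE andbC.
Qed.

Lemma dim_addv_line S (x : vT) : \dim (S + <[x]>) = (\dim S + (x \notin S))%N.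
Proof.
have [xS|xS] := boolP (x \in S); first by rewrite addn0 (addv_idPl _).
rewrite dimv_disjoint_sum ?dim_vline; last first.
  apply/eqP; rewrite -subv0; apply/subvP => y; rewrite memv_cap => /andP[yS].
  case/vlineP => a yE; rewrite memv0 yE; move: yS; rewrite yE.
  have [->|a0 aS] := eqVneq a 0; first by rewrite scale0r.
  by rewrite -(scalerK a0 x) memvZ in xS.
by have [x0|//] := eqVneq x 0; rewrite x0 mem0v in xS.
Qed.

(** Induction on k - dim S, counting pairs (C, x) with x in C outside S: for fixed x, the spaces C
    form the interval above S + <x>. *)
Lemma card_vspace_interval S W k : (S <= W)%VS -> (\dim S <= k)%N ->
  #|[set C | (S <= C <= W)%VS & \dim C == k]|
  = gauss Q (\dim W - \dim S) (k - \dim S).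
Proof.
move=> sSW /subnKC <-; move: (k - _)%N => r; rewrite addKn {k}.
elim: r S sSW => [|r IHr] S sSW.
  rewrite gauss0 addn0 (_ : [set _ | _] = [set S]) ?cards1 //.
  apply/setP => C; rewrite !inE; apply/idP/eqP => [/andP[/andP[sSC _] dC]|->].
    by apply/esym/eqP; rewrite eqEdim sSC (eqP dC) /=.
  by rewrite subvv sSW eqxx.
set A := [set _ | _]; set N := #|A|.
have Q0 : (0 < Q)%N by rewrite ltnW ?finNzRing_gt1.
have count : (N * (Q ^ (\dim S + r.+1) - Q ^ \dim S))%N =
  ((Q ^ \dim W - Q ^ \dim S) * gauss Q (\dim W - (\dim S).+1) r)%N.
  transitivity (\sum_(C in A) #|[pred x : T | (x \in C) && (x \notin S)]|)%N.
    rewrite -sum_nat_const; apply: eq_bigr => C; rewrite inE.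
    by case/andP => /andP[sSC _] /eqP dC; rewrite card_vspaceB // dC.
  rewrite -(card_vspaceB sSW) -sum_nat_const.
  under eq_bigr => C _ do rewrite -sum1_card big_mkcond.
  rewrite exchange_big /= [RHS]big_mkcond; apply: eq_bigr => x _.
  rewrite -big_mkcondr sum1_card !inE.
  case: ifP => [/andP[xW xS]|xWS]; last first.
    rewrite (@eq_card0 _ _) // => C; rewrite unfold_in /= inE; apply/negP.
    case/andP => /andP[/andP[_ /subvP sCW] _] /andP[/sCW xW xS].
    by rewrite xW xS in xWS.
  have sSxW : (S + <[x : vT]> <= W)%VS by rewrite subv_add sSW -memvE.
  have dSx : \dim (S + <[x : vT]>) = (\dim S).+1 by rewrite dim_addv_line xS addn1.
  rewrite -dSx -IHr // dSx; apply: eq_card => C; rewrite [LHS]unfold_in /=.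
  by rewrite !inE xS andbT subv_add -memvE addSnnS; case: (x \in C);
    rewrite ?andbT ?andbF.
(* If S = W there is no such x, and the count forces N = 0; otherwise Q^(dim S) can be cancelled
   before applying [gauss_absorb]. *)
case: (eqVneq (\dim S) (\dim W)) => [eSW|neSW].
  rewrite -eSW subnn /=; move: count; rewrite -eSW subnn mul0n => /eqP.
  rewrite muln_eq0 => /orP[/eqP //|]; rewrite subn_eq0 leq_exp2l ?finNzRing_gt1 //.
  by lia.
have lt : (\dim S < \dim W)%N by rewrite ltn_neqAle neSW dimvS.
have [w dW] : exists w, \dim W = (\dim S + w.+1)%N.
  by exists (\dim W - (\dim S).+1)%N; lia.
move: count; rewrite dW addKn.
have -> : (\dim S + w.+1 - (\dim S).+1 = w)%N by lia.
rewrite !expnD -[X in (_ - X)%N]muln1 -[X in (_ = (_ - X) * _)%N -> _]muln1.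
rewrite -!mulnBr mulnCA -mulnA => /eqP; rewrite eqn_pmul2l ?expn_gt0 ?Q0 //.
rewrite -gauss_absorb ?finNzRing_gt1 // eqn_pmul2r; first by move/eqP.
by rewrite subn_gt0 -(expn0 Q) ltn_exp2l // finNzRing_gt1.
Qed.

(** The entries are chosen in turn, each outside the span of S and its predecessors. If r exceeds
    dim W - dim S, the factor at j = dim W - dim S is zero. *)
Lemma card_vspace_tuples S W r : (S <= W)%VS ->
  #|[set X : r.-tuple T | all [in W] X & \dim (S + <<X : seq vT>>) == (\dim S + r)%N]|
  = (\prod_(j < r) (Q ^ \dim W - Q ^ (\dim S + j)))%N.
Proof.
elim: r S => [|r IHr] S sSW.
  rewrite big_ord0 -[RHS](card_tuple 0 T); apply: eq_card => X.
  by rewrite !inE tuple0 /= span_nil addv0 addn0 eqxx.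
rewrite big_ord_recl addn0 -(card_vspaceB sSW) -sum_nat_const.
pose f (X : T * r.-tuple T) := [tuple of X.1 :: X.2].
have f_inj : injective f.
  by move=> [x X] [y Y] /(congr1 val) /= [-> /val_inj ->].
set A := [set _ | _].
transitivity (\sum_(x : T) \sum_(X : r.-tuple T | f (x, X) \in A) 1)%N.
  rewrite pair_big_dep /= sum1_card -(card_image f_inj); apply: eq_card => X.
  apply/idP/imageP => [XA|[[x Y] YA ->]] //.
  exists (thead X, [tuple of behead X]); last by rewrite /f /= -tuple_eta.
  by rewrite unfold_in /f -tuple_eta.
rewrite [RHS]big_mkcond; apply: eq_bigr => x _; rewrite sum1_card !inE.
case: ifP => [/andP[xW xS]|xWS].
  have sSxW : (S + <[x : vT]> <= W)%VS by rewrite subv_add sSW -memvE.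
  have dSx : \dim (S + <[x : vT]>) = (\dim S).+1 by rewrite dim_addv_line xS addn1.
  transitivity (\prod_(j < r) (Q ^ \dim W - Q ^ (\dim (S + <[x : vT]>) + j)))%N.
    rewrite -IHr //; apply: eq_card => X.
    by rewrite -[LHS]/(f (x, X) \in A) !inE /= xW span_cons addvA dSx addSnnS.
  by apply: eq_bigr => j _; rewrite dSx addSnnS.
(* A head x in S adds no dimension, and the r remaining vectors add at most r. *)
apply: eq_card0 => X; rewrite -[LHS]/(f (x, X) \in A) !inE /=;
  apply/negP => /andP[/andP[xW _]].
move/eqP; rewrite span_cons addvA.
have xS : x \in S by move: xWS; rewrite xW /= => /negbFE.
rewrite (addv_idPl (xS : (<[x : vT]> <= S)%VS)) => dE.
have [] := (dimv_add_leqif S <<X : seq vT>>); rewrite dE => le1 _.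
by have := dim_span (X : seq vT); rewrite size_tuple; lia.
Qed.
End CountingSubspaces.

(** * Moebius inversion and Lambda *)

Section SubspaceSums.
Variables (K : finFieldType) (T : finType) (cvT : Vector K T).
Let vT : vectType K := Vector.Pack cvT.
Implicit Types (S C W U : {vspace vT}).
Local Notation Q := #|K|.

Lemma card_subvspaces W k :
  #|[set C | (C <= W)%VS & \dim C == k]| = gauss Q (\dim W) k.
Proof.
have := @card_vspace_interval _ _ cvT 0 W k (sub0v W);
  rewrite dimv0 !subn0 => <- //.
by apply: eq_card => C; rewrite !inE sub0v.
Qed.

Lemma sum_subvspaces (f : nat -> int) W :
  \sum_(S | (S <= W)%VS) f (\dim S)
  = \sum_(0 <= i < (\dim W).+1) f i * (gauss Q (\dim W) i)%:Z.
Proof.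
rewrite big_mkord.
rewrite (partition_big (fun S => inord (\dim S) : 'I_(\dim W).+1) predT) //=.
apply: eq_bigr => i _; rewrite -card_subvspaces -natz mulr_natr -sumr_const.
apply: eq_big => [S|S /andP[sSW /eqP <-]].
  rewrite inE; apply: andb_id2l => sSW.
  by rewrite -val_eqE /= inordK // ltnS dimvS.
by rewrite inordK // ltnS dimvS.
Qed.

(* The Moebius function of the lattice of subspaces is
   [(-1) ^ s * Q ^ 'C(s, 2)] on an interval of length [s]. *)
Lemma card_vspace_meet (N t k : nat) U :
  \dim {:vT} = N -> \dim U = t -> (t <= N)%N -> (k <= N)%N ->
  (#|[set C | \dim C == k & (C :&: U != 0)%VS]|)%:Z
  = \sum_(1 <= s < t.+1) - ((-1) ^+ s * Q%:Z ^+ 'C(s, 2) * (gauss Q t s)%:Z)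
                         * (gauss Q (N - s) (N - k))%:Z.
Proof.
move=> dN dU le_tN le_kN.
(* Minus the Moebius function, except for the value 0 at the zero space: summed over the subspaces
   of W, it gives the indicator of W != 0. *)
pose g (s : nat) : int := if s is 0 then 0 else - ((-1) ^+ s * Q%:Z ^+ 'C(s, 2)).
have g_sum W : \sum_(S | (S <= W)%VS) g (\dim S) = (W != 0%VS)%:R.
  rewrite sum_subvspaces big_nat_recl // mul0r add0r.
  have := gauss_alternating Q (\dim W).
  rewrite big_nat_recl // gauss0 !mulr1 expr0 dimv_eq0.
  under [X in _ -> X = _]eq_bigr => i _ do rewrite mulNr.
  by rewrite sumrN => /eqP; rewrite addrC eq_sym -subr_eq => /eqP <-; case: eqP.
(* The lower index N - k, rather than k - dim S, also gives the correct value 0 when dim S > k. *)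
have cnt S : #|[set C | (S <= C)%VS & \dim C == k]| = gauss Q (N - \dim S) (N - k).
  have le_SN : (\dim S <= N)%N by rewrite -dN dimvS ?subvf.
  have [le_Sk|lt_kS] := leqP (\dim S) k; last first.
    rewrite gauss_small; last by lia.
    apply: eq_card0 => C; rewrite !inE; apply/negP => /andP[/dimvS + /eqP dC].
    by rewrite dC leqNgt lt_kS.
  have -> : (N - k = N - \dim S - (k - \dim S))%N by lia.
  rewrite gauss_sub ?finNzRing_gt1 //; last by lia.
  rewrite -dN -card_vspace_interval ?subvf //; apply: eq_card => C.
  by rewrite !inE subvf andbT.
transitivity (\sum_(C | \dim C == k) \sum_(S | (S <= C :&: U)%VS) g (\dim S)).
  rewrite -sum1_card -natz natr_sum; under [LHS]eq_bigl => C do rewrite inE.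
  rewrite [RHS](eq_bigr (fun C => (C :&: U != 0)%VS%:R)) => [|C _];
    last exact: g_sum.
  by rewrite big_mkcondr; apply: eq_bigr => C _; case: ifP.
under eq_bigr => C _ do (under eq_bigl => S do rewrite subv_cap andbC; rewrite big_mkcondr).
rewrite exchange_big /=.
rewrite (eq_bigr (fun S => g (\dim S) * (gauss Q (N - \dim S) (N - k))%:Z)).
  rewrite (sum_subvspaces (fun s => g s * (gauss Q (N - s) (N - k))%:Z)) dU.
  rewrite [LHS]big_nat_recl //= !mul0r add0r [RHS]big_add1.
  by apply: eq_bigr => i _ /=; ring.
move=> S _; rewrite -big_mkcondr -cnt -natz mulr_natr -sumr_const.
by apply: eq_bigl => C; rewrite inE andbC.
Qed.
End SubspaceSums.

Lemma qbinom_gauss (K : finFieldType) (a b : nat) :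
  qbinom K a b = gauss #|K| a b.
Proof.
have fa : \dim {:'rV[K]_a} = a by rewrite dimvf; exact: mul1n.
rewrite -[in RHS]fa -card_subvspaces /=.
by apply: eq_card => C; rewrite !inE subvf.
Qed.

(** After exchanging the sums, [gauss_mul] isolates an inner sum over h that is an alternating sum
    without its term h = 0. *)
Lemma LambdaE (K : finFieldType) (N t k : nat) : (t <= N)%N -> (k <= N)%N ->
  Lambda K N t k =
  \sum_(1 <= s < t.+1) - ((-1) ^+ s * #|K|%:Z ^+ 'C(s, 2) * (gauss #|K| t s)%:Z)
                         * (gauss #|K| (N - s) (N - k))%:Z.
Proof.
move=> le_tN le_kN; rewrite /Lambda.
pose a (i : nat) : int := (-1) ^+ i * #|K|%:Z ^+ 'C(i, 2).
transitivity (\sum_(1 <= h < t.+1) \sum_(1 <= s < t.+1 | (h <= s)%N)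
   (gauss #|K| t s * gauss #|K| s h)%:Z * (gauss #|K| (N - s) (N - k))%:Z * a (s - h)%N).
  apply: eq_big_nat => h /andP[h_gt0 le_ht].
  rewrite [RHS](big_cat_nat (n := h)) //; last by rewrite ltnW.
  rewrite [X in _ = X + _]big_nat_cond [X in _ = X + _]big1 ?add0r; last first.
    by move=> s /andP[/andP[_ lt_sh]]; rewrite leqNgt lt_sh.
  rewrite [RHS]big_nat_cond [RHS](eq_bigl (fun s => h <= s < t.+1)%N);
    last first.
    by move=> s /=; case: (h <= s)%N; rewrite ?andbT ?andbF.
  rewrite -big_nat mulr_sumr; apply: eq_big_nat => s /andP[le_hs le_st].
  rewrite -gauss_mul ?finNzRing_gt1 ?le_hs //.
  rewrite !subzn ?qbinom_gauss ?PoszM /a; [ring | lia..].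
under eq_bigr => h _ do rewrite big_mkcond.
rewrite exchange_big_nat /=; apply: eq_big_nat => s /andP[s_gt0 le_st].
rewrite -big_mkcond /=.
(* Since s > 0 the full alternating sum is zero, so what remains is minus the missing term,
   [a s]. *)
have reversed : \sum_(1 <= h < s.+1) (gauss #|K| s h)%:Z * a (s - h)%N = - a s.
  have := gauss_alternating #|K| s.
  rewrite eqn0Ngt s_gt0 big_nat_rev /= add0n big_nat_recl // subn1 /= gaussnn.
  rewrite mulr1 -/(a s) => /eqP; rewrite addrC addr_eq0 => /eqP <-.
  rewrite big_add1 /=; apply: eq_big_nat => h /andP[_ lt_hs].
  by rewrite subSS gauss_sub ?finNzRing_gt1 // mulrC.
rewrite -/(a s) -mulNr -reversed !mulr_suml.
rewrite [RHS](big_nat_widen _ _ t.+1) //; apply: eq_bigr => h _.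
by rewrite PoszM; ring.
Qed.

(** * Rank weights and bad codes *)

Section RankWeights.
Variables (F : finFieldType) (L : fieldExtType F) (n : nat).
Local Notation K := (finvect_type L).
Local Notation q := #|F|.
Local Notation m := (\dim {:L}).
Implicit Types (x : 'rV[K]_n) (C : {vspace 'rV[K]_n}).

Lemma card_finvect : #|K| = (q ^ m)%N.
Proof. by rewrite -(card_vspace {:K}) card_vspacef. Qed.

(** As d <= n, the neutral value n of the minimum is never below d; in particular the zero code is
    not bad. *)
Lemma rk_min_dist_lt C d : (d <= n)%N ->
  (rk_min_dist C < d)%N =
  [exists x : 'rV[K]_n, [&& x \in C, x != 0 & (rk_weight x < d)%N]].
Proof.
move=> le_dn; transitivity (has (fun x => [&& x \in C, x != 0 & (rk_weight x < d)%N])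
                               (index_enum 'rV[K]_n)); last first.
  apply/hasP/existsP => [[x _ xP]|[x xP]]; exists x => //;
    exact: mem_index_enum.
rewrite /rk_min_dist; elim: (index_enum _) => [|x s IHs].
  by rewrite big_nil /= ltnNge le_dn.
rewrite big_cons /= -IHs; case: (x \in C) => //=; case: (x != 0) => //=.
by rewrite gtn_min.
Qed.

(** The image of this map is the span of the components of x, so the rank weight is the rank of a
    linear map and rank-nullity applies. *)
Definition coord_comb x (a : 'rV[F]_n) : K := \sum_j a ord0 j *: x ord0 j.

Lemma coord_comb_linear x : linear (coord_comb x).
Proof.
move=> c a b; rewrite /coord_comb scaler_sumr -big_split /=.
by apply: eq_bigr => j _; rewrite !mxE scalerDl scalerA.
Qed.

HB.instance Definition _ x :=
  GRing.isLinear.Build F 'rV[F]_n K _ (coord_comb x) (coord_comb_linear x).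

Local Notation coord_hom x := (linfun (coord_comb x)).

Lemma coord_hom_delta x j : coord_hom x (delta_mx ord0 j) = x ord0 j.
Proof.
rewrite lfunE /= /coord_comb (bigD1 j) //= mxE !eqxx scale1r big1 ?addr0 //.
by move=> i neij; rewrite mxE (negbTE neij) andbF scale0r.
Qed.

Lemma dim_limg_coord_hom x : \dim (limg (coord_hom x)) = rk_weight x.
Proof.
congr (\dim _); apply/eqP; rewrite eqEsubv; apply/andP; split.
  apply/subvP => y /memv_imgP[a _ ->]; rewrite lfunE /=.
  by apply: memv_suml => j _; apply/memvZ/memv_span/image_f.
apply/span_subvP => y /imageP[j _ ->]; rewrite -coord_hom_delta.
exact/memv_img/memvf.
Qed.

(* A vector of rank weight [i] is determined by the kernel, of dimension
   [n - i], of the linear map [a |-> \sum_j a_j x_j] on F^n, and by the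
   (linearly independent) images of a basis of a complement. *)
Lemma card_rk_weight_le i :
  (#|[set x : 'rV[K]_n | rk_weight x == i]|
   <= gauss q n i * \prod_(j < i) (q ^ m - q ^ j))%N.
Proof.
have [le_in|lt_ni] := leqP i n; last first.
  rewrite gauss_small // leqn0 cards_eq0; apply/eqP/setP => x; rewrite !inE;
    apply/negbTE.
  rewrite neq_ltn; apply/orP; left; apply: leq_ltn_trans lt_ni.
  by apply: leq_trans (dim_span _) _; rewrite size_image card_ord.
have dim_rV : \dim {:'rV[F]_n} = n by rewrite dimvf; exact: mul1n.
pose b x := vbasis (lker (coord_hom x))^C.
pose code x := (lker (coord_hom x), [tuple coord_hom x (b x)`_l | l < i]).
have dim_ker x : (\dim (lker (coord_hom x)) + rk_weight x = n)%N.
  by rewrite -dim_limg_coord_hom -[in RHS]dim_rV -(limg_ker_dim (coord_hom x) fullv) capfv.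
have dim_compl x : \dim (lker (coord_hom x))^C = rk_weight x.
  by rewrite dimv_compl dim_rV; have := dim_ker x; lia.
have b_im x : rk_weight x = i ->
    [tuple coord_hom x (b x)`_l | l < i] = [seq coord_hom x v | v <- b x] :> seq K.
  move=> wx; apply: (@eq_from_nth _ 0); rewrite ?size_tuple ?size_map ?size_tuple ?dim_compl //.
  move=> l lt_li; rewrite (nth_map 0) ?size_tuple ?dim_compl ?wx //.
  by rewrite -[l]/(val (Ordinal lt_li)) -tnth_nth tnth_mktuple.
(* The basis [b x] depends only on the kernel. Equal codes thus give maps that agree on the kernel
   and on a basis of its complement, hence everywhere. *)
have code_inj : {in [set x : 'rV[K]_n | rk_weight x == i] &, injective code}.
  move=> x y; rewrite !inE => /eqP wx /eqP wy codeE.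
  have /= eker := congr1 fst codeE.
  have ebasis : [seq coord_hom x v | v <- b x] = [seq coord_hom y v | v <- b y].
    rewrite -(b_im x wx) -(b_im y wy).
    by have := congr1 (fun c => tval c.2) codeE.
  have : (fullv <= lker (coord_hom x - coord_hom y))%VS.
    rewrite -(addv_complf (lker (coord_hom x))) subv_add; apply/andP; split.
      apply/eqlfun_inP => a aV; have := aV; rewrite eker !memv_ker => /eqP ->.
      by move: aV; rewrite memv_ker => /eqP ->.
    rewrite -(span_basis (vbasisP (lker (coord_hom x))^C));
      apply/span_subvP => v vb; apply/eqlfunP.
    have : [seq coord_hom x v | v <- b x] = [seq coord_hom y v | v <- b x].
      by rewrite ebasis /b eker.
    by move/eq_in_map; apply.
  move/subvP => xy; apply/rowP => j; rewrite -!coord_hom_delta.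
  by apply/eqlfunP/xy/memvf.
rewrite -(card_in_imset code_inj).
rewrite -(gauss_sub (finNzRing_gt1 F) le_in) -[in gauss _ _ _]dim_rV -card_subvspaces.
have := card_vspace_tuples i (sub0v {:K}).
rewrite dimv0 => /esym; under eq_bigr => j _ do rewrite add0n.
move=> ->; rewrite -cardsX; apply/subset_leq_card/subsetP => c /imsetP[x].
rewrite inE => /eqP wx ->; rewrite !inE /= subvf add0n add0v; apply/and3P;
  split.
- rewrite dim_rV /=; apply/eqP/(@addIn (rk_weight x));
  rewrite dim_ker wx subnK //.
- by apply/allP => v _; exact: memvf.
rewrite (b_im _ wx) -limg_span (span_basis (vbasisP _)) -wx -dim_limg_coord_hom.
rewrite -(addv_complf (lker (coord_hom x))) limgD.
by rewrite (_ : (_ @: lker _)%VS = 0%VS) ?add0v //; apply/eqP; rewrite -lkerE.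
Qed.

Lemma card_rk_ball_le_sum r :
  (#|[set x : 'rV[K]_n | (rk_weight x <= r)%N]|
   <= \sum_(i < r.+1) gauss q n i * \prod_(j < i) (q ^ m - q ^ j))%N.
Proof.
rewrite -sum1_card.
rewrite (partition_big (fun x => inord (rk_weight x) : 'I_r.+1) predT) //=.
apply: leq_sum => i _; apply: leq_trans (card_rk_weight_le i);
  rewrite sum1_card.
apply/subset_leq_card/subsetP => x; rewrite unfold_in /= !inE => /andP[wx /eqP <-].
by rewrite inordK.
Qed.

Lemma card_rk_ball_le r : (r <= m)%N ->
  (#|[set x : 'rV[K]_n | (rk_weight x <= r)%N]|)%:Z <= rk_ball_size F m n r.
Proof.
move=> le_rm; have := card_rk_ball_le_sum r; rewrite -lez_nat => /le_trans;
  apply.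
rewrite /rk_ball_size; under [leRHS]eq_bigr => i _ do rewrite qbinom_gauss.
rewrite big_mkord (big_morph Posz PoszD (erefl _)) le_eqVlt; apply/orP; left.
apply/eqP/eq_bigr => i _; rewrite PoszM (big_morph Posz PoszM (erefl _)) big_mkord.
congr (_ * _); apply: eq_bigr => j _.
rewrite -subzn ?leq_exp2l ?finNzRing_gt1 //; last first.
  by rewrite (leq_trans _ le_rm) // ltnW // (leq_trans (ltn_ord j)) // -ltnS.
by rewrite -!natz !natrX.
Qed.

(** * Bounds on the number of bad codes *)

Lemma rk_weight0 : rk_weight (0 : 'rV[K]_n) = 0%N.
Proof.
apply/eqP; rewrite dimv_eq0 -subv0; apply/span_subvP => _ /imageP[j _ ->].
by rewrite mxE mem0v.
Qed.

(** Multiplication by a is F-linear on L and maps the span of the components of x onto that of a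
    x. *)
Lemma rk_weightZ_le (a : K) x : (rk_weight (a *: x) <= rk_weight x)%N.
Proof.
rewrite -[X in (_ <= X)%N](limg_ker_dim (amull (a : L))) .
apply: leq_trans (leq_addl _ _).
rewrite limg_span -map_comp; apply/eq_leq; congr (\dim (span _)).
by apply: eq_map => j /=; rewrite mxE lfunE.
Qed.

Lemma card_bad_codes_le k d : (0 < k)%N -> (0 < n)%N -> (0 < d <= n)%N ->
  (#|bad_codes L n k d| * (#|K| - 1) <=
   (#|[set x : 'rV[K]_n | (rk_weight x <= d - 1)%N]| - 1)
   * gauss #|K| (n - 1) (k - 1))%N.
Proof.
move=> k_gt0 n_gt0 /andP[d_gt0 le_dn]; set B := [set x : 'rV[K]_n | _].
pose B0' := B :\ 0; have B0 : 0 \in B by rewrite inE rk_weight0.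
have dim_rV : \dim {:'rV[K]_n} = n by rewrite dimvf; exact: mul1n.
rewrite -[leqLHS]sum_nat_const.
apply: (@leq_trans (\sum_(C in bad_codes L n k d) #|[pred x in B0' | x \in C]|)%N).
  apply: leq_sum => C; rewrite !inE => /andP[/eqP dC].
  rewrite rk_min_dist_lt // => /existsP[x /and3P[xC x0 wx]].
  (* The Q - 1 light vectors of a bad code are the non-zero multiples of a single one. *)
  have -> : (#|K| - 1 = #|[pred a : K | a != 0%R]|)%N.
    by rewrite subn1 -(cardC1 (0 : K)); apply: eq_card.
  have inj : injective (fun a : K => a *: x).
    by move=> a b /eqP; rewrite -subr_eq0 -scalerBl scaler_eq0 (negbTE x0) orbF subr_eq0 => /eqP.
  rewrite -(card_image inj); apply/subset_leq_card/subsetP => y /imageP[a];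
    rewrite inE => a0 ->.
  rewrite !inE scaler_eq0 negb_or a0 x0 memvZ // andbT /=.
  by apply: leq_trans (rk_weightZ_le a x) _; rewrite -ltnS subn1 prednK.
have -> : (#|B| - 1 = #|B0'|)%N by rewrite (cardsD1 0%R B) B0 addKn.
rewrite -sum_nat_const.
under eq_bigr => C _ do rewrite -sum1_card big_mkcondr.
rewrite exchange_big /=; apply: leq_sum => x; rewrite !inE => /andP[x0 _].
rewrite -big_mkcondr sum1_card.
have := @card_vspace_interval K 'rV[K]_n _ <[x]>%VS fullv k (subvf _).
rewrite dim_vline x0 dim_rV => <- //.
apply/subset_leq_card/subsetP => C; rewrite unfold_in /= !inE subvf andbT.
by case/andP => /andP[/eqP -> _] xC; rewrite eqxx -memvE xC.
Qed.

Lemma exists_low_rank_space t : (t <= n)%N ->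
  exists2 U : {vspace 'rV[K]_n}, \dim U = t &
    forall x, x \in U -> (rk_weight x <= t)%N.
Proof.
move=> le_tn; pose P : 'M[K]_(t, n) := pid_mx t.
have P_inj (u : 'rV[K]_t) : u *m P *m (pid_mx t : 'M_(n, t)) = u.
  by rewrite -mulmxA mul_pid_mx !(minn_idPr _) // pid_mx_1 mulmx1.
exists (limg (linfun (mulmxr P : 'rV[K]_t -> 'rV[K]_n))).
  rewrite limg_dim_eq ?dimvf; first exact: mul1n.
  rewrite capfv; apply/eqP; rewrite -subv0; apply/subvP => u.
  by rewrite memv_ker memv0 lfunE /= => /eqP uP0; rewrite -(P_inj u) uP0 mul0mx.
move=> _ /memv_imgP[u _ ->]; rewrite lfunE /=.
(* The entries of [P] are 0 or 1, so the components of the image stay in the F-span of the t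
   components of u. *)
apply: leq_trans (_ : \dim <<[seq (u ord0 i : L) | i : 'I_t]>> <= t)%N;
  last first.
  by apply: leq_trans (dim_span _) _; rewrite size_image card_ord.
apply/dimvS/span_subvP => _ /imageP[j _ ->]; rewrite mxE.
apply: memv_suml => i _; rewrite mxE mulr_natr.
by rewrite rpredMn // memv_span // (image_f (fun i => (u ord0 i : L))).
Qed.

Lemma meet_bad_codes (k d : nat) (U : {vspace 'rV[K]_n}) : (0 < d <= n)%N ->
  (forall x, x \in U -> (rk_weight x <= d - 1)%N) ->
  [set C | \dim C == k & (C :&: U != 0)%VS] \subset bad_codes L n k d.
Proof.
case/andP => d_gt0 le_dn wU; apply/subsetP => C;
  rewrite !inE => /andP[-> meet] /=.
rewrite rk_min_dist_lt //; apply/existsP; exists (vpick (C :&: U)).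
have := memv_pick (C :&: U)%VS; rewrite vpick0 meet memv_cap => /andP[-> /wU wx] /=.
by rewrite -(subnK d_gt0) addn1 ltnS.
Qed.

Lemma Lambda_le_card_bad_codes k d : (k <= n)%N -> (0 < d <= n)%N ->
  Lambda K n (d - 1) k <= (#|bad_codes L n k d|)%:Z.
Proof.
move=> le_kn d_bounds; have /andP[d_gt0 le_dn] := d_bounds.
have le_tn : (d - 1 <= n)%N by lia.
have [U dU wU] := exists_low_rank_space le_tn.
rewrite LambdaE // -(card_vspace_meet _ dU) //; last first.
  by rewrite dimvf; exact: mul1n.
by rewrite lez_nat; apply/subset_leq_card/meet_bad_codes.
Qed.

Lemma card_bad_codes_ge k d : (0 < k)%N -> (0 < d <= n)%N ->
  ((#|K| ^ (d - 1) - 1) * \prod_(j < k - 1) (#|K| ^ n - #|K| ^ (d - 1 + j))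
   <= #|bad_codes L n k d| * #|K| ^ (1 + k * (k - 1)))%N.
Proof.
move=> k_gt0 d_bounds; have /andP[d_gt0 le_dn] := d_bounds.
have dim_rV : \dim {:'rV[K]_n} = n by rewrite dimvf; exact: mul1n.
have le_tn : (d - 1 <= n)%N by lia.
have [U dU wU] := exists_low_rank_space le_tn.
set r := (k - 1)%N.
pose good (S W : {vspace 'rV[K]_n}) :=
  [set X : r.-tuple 'rV[K]_n | all [in W] X & \dim (S + <<X>>) == (\dim S + r)%N].
pose A := setX [set x | (x \in U) && (x \notin 0%VS)] (good U fullv).
have -> : ((#|K| ^ (d - 1) - 1) * \prod_(j < r) (#|K| ^ n - #|K| ^ (d - 1 + j)))%N = #|A|.
  rewrite cardsX card_vspace_tuples ?subvf // dU dim_rV; congr (_ * _)%N.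
  have := card_vspaceB (sub0v U); rewrite dU dimv0 expn0 => <-.
  by apply: eq_card => x; rewrite !inE.
pose code (p : 'rV[K]_n * r.-tuple 'rV[K]_n) := (<[p.1]> + <<p.2>>)%VS.
have codeP p : p \in A ->
    [/\ \dim (code p) = k, (code p :&: U)%VS = <[p.1]>%VS & p.2 \in good <[p.1]>%VS (code p)].
  case: p => x X; rewrite !inE memv0 /= => /andP[/andP[xU x0] /andP[_ /eqP dUX]].
  have dx : \dim <[x]> = 1%N by rewrite dim_vline x0.
  have sxU : (<[x]> <= U)%VS by rewrite -memvE.
  have dX : (\dim <<X>> <= r)%N by apply: leq_trans (dim_span _) _;
    rewrite size_tuple.
  have sxC : (<[x]> <= (<[x]> + <<X>>) :&: U)%VS by rewrite subv_cap addvSl.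
  have le_dC : (\dim (<[x]> + <<X>>) <= 1 + r)%N.
    by apply: leq_trans (dimv_add_leqif _ _) _; rewrite dx leq_add2l.
  (* For C = <x> + <X>, dim(C + U) = dim U + r gives dim C = r + dim(C cap U). As C cap U contains x
     and dim C <= 1 + r, both dimensions are forced. *)
  have := dimv_sum_cap (<[x]> + <<X>>)%VS U.
  rewrite addvC addvA (addv_idPl sxU) dUX => dE.
  have ge_dcap := dimvS sxC; rewrite dx in ge_dcap.
  have arith (a b u : nat) : (u + r + b = a + u -> 0 < b -> a <= 1 + r ->
    a = 1 + r /\ b = 1)%N by lia.
  have [dC dcap] := arith _ _ _ dE ge_dcap le_dC.
  split; first by rewrite dC /r; lia.
    by apply/esym/eqP; rewrite eqEdim sxC dx dcap.
  rewrite dC dx eqxx andbT; apply/allP => v vX.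
  by apply: (subvP (addvSr _ _)); exact: memv_span.
rewrite -sum1_card (partition_big code [in bad_codes L n k d]) /=; last first.
  move=> p pA; have [dC meet _] := codeP _ pA.
  apply: (subsetP (meet_bad_codes _ d_bounds wU)); rewrite inE dC eqxx meet /=.
  by rewrite -dimv_eq0 dim_vline; move: pA;
    rewrite !inE memv0 => /andP[/andP[_ ->]].
rewrite -sum_nat_const; apply: leq_sum => C _; rewrite sum1_card.
have [p /andP[pA /eqP codep]|none] := pickP [pred p | (p \in A) && (code p == C)]; last first.
  by rewrite eq_card0.
have [dC meet _] := codeP _ pA; rewrite codep in dC meet.
(* In the fibre over C, x lies on the line C cap U, which has Q elements, and X consists of k - 1
   vectors of C, at most Q^k choices each. *)
apply: leq_trans (_ : #|setX [set x | x \in (C :&: U)%VS] (good (C :&: U)%VS C)| <= _)%N.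
  apply/subset_leq_card/subsetP => p' /andP[p'A /eqP codep'].
  have [_ meet' good'] := codeP _ p'A; rewrite codep' in meet' good'.
  by rewrite !inE meet' memv_line /=; move: good'; rewrite inE.
have x0 : p.1 != 0 by move: pA; rewrite !inE memv0 => /andP[/andP[_ ->]].
rewrite cardsX card_vspace_tuples ?capvSl // meet dim_vline x0 dC.
rewrite cardsE card_vspace dim_vline x0 expnD leq_mul2l; apply/orP; right.
apply: (@leq_trans (\prod_(j < r) #|K| ^ k)%N).
  by apply: leq_prod => j _; exact: leq_subr.
by rewrite prod_nat_const card_ord expnM.
Qed.
End RankWeights.

(** * Density estimates *)

Section DensityBounds.
Variables (F : finFieldType) (L : fieldExtType F) (n k d : nat).
Hypotheses (k_bounds : (0 < k <= n)%N) (d_bounds : (1 < d <= n)%N).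
Local Notation K := (finvect_type L).
Local Notation q := #|F|.
Local Notation Q := #|K|.

Lemma card_codes : #|codes L n k| = gauss Q n k.
Proof. exact: (qbinom_gauss K n k). Qed.

Lemma half_le_expB1 a : (0 < a)%N -> (Q ^ a <= 2 * (Q ^ a - 1))%N.
Proof.
move=> a_gt0; have : (2 <= Q ^ a)%N; last by lia.
by rewrite -(expn0 Q) ltn_exp2l // finNzRing_gt1.
Qed.

(** One factor 2^k comes from [gauss_le]; the other from the k differences of powers of Q in
    [card_bad_codes_ge], each at least half its leading term. *)
Lemma card_codes_le_bad_codes : (d + k - 2 <= n)%N ->
  (#|codes L n k| * Q ^ (d + k - 2) <= 2 ^ (2 * k) * #|bad_codes L n k d| * Q ^ n)%N.
Proof.
have Q_gt1 : (1 < Q)%N := finNzRing_gt1 K.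
have [/andP[k_gt0 le_kn] /andP[d_gt1 le_dn]] := (k_bounds, d_bounds).
move=> dk_le_n; have Qp e : (0 < Q ^ e)%N by rewrite expn_gt0 ltnW.
rewrite card_codes -(leq_pmul2r (Qp (1 + k * (k - 1))%N)).
set b := #|bad_codes L n k d|.
have lb : (Q ^ (d - 1) * Q ^ (n * (k - 1)) <= 2 ^ k * (b * Q ^ (1 + k * (k - 1))))%N.
  have d_gt0 : (0 < d <= n)%N by rewrite ltnW.
  apply: leq_trans (leq_mul (leqnn (2 ^ k)) (card_bad_codes_ge L k_gt0 d_gt0)).
  have -> : (2 ^ k = 2 * 2 ^ (k - 1))%N by rewrite -expnS; congr expn; lia.
  rewrite mulnACA leq_mul ?half_le_expB1 //; first by lia.
  have -> : (2 ^ (k - 1) = \prod_(j < k - 1) 2)%N by rewrite prod_nat_const card_ord.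
  rewrite -big_split /= expnM.
  have -> : ((Q ^ n) ^ (k - 1) = \prod_(j < k - 1) (Q ^ n))%N.
    by rewrite prod_nat_const card_ord.
  apply: leq_prod => j _; have lt_j := ltn_ord j.
  (* Here j <= k - 2, so d + j <= d + k - 2 <= n. *)
  suff : (2 * Q ^ (d - 1 + j) <= Q ^ n)%N by lia.
  apply: leq_trans (leq_mul Q_gt1 (leqnn _)) _.
  by rewrite -expnS leq_exp2l //; lia.
apply: leq_trans (_ : (2 ^ k * Q ^ n * (2 ^ k * (b * Q ^ (1 + k * (k - 1)))) <= _)%N).
  apply: leq_trans (leq_mul (leqnn _) lb).
  apply: leq_trans (leq_mul (leq_mul (gauss_le Q_gt1 le_kn) (leqnn _)) (leqnn _)) _.
  rewrite -!mulnA leq_mul2l -!expnD leq_exp2l //; apply/orP; right.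
  (* Both exponents of Q equal n k + d - 1; the substitutions remove truncated subtractions. *)
  have [j ->] : exists j, n = (k + j)%N by exists (n - k)%N; lia.
  have [i ->] : exists i, k = i.+1 by exists k.-1; lia.
  rewrite addKn subn1 /=; nia.
rewrite [(2 * k)%N]mul2n -addnn (expnD 2 k k); apply: eq_leq. ring.
Qed.

(** The 4 comes from Q <= 2 (Q - 1) and Q^n <= 2 (Q^n - 1). The sum bounds the ball size divided by
    Q^(d-1), and does not depend on m. *)
Lemma card_bad_codes_le_codes :
  (#|bad_codes L n k d| * Q ^ n
   <= 4 * (\sum_(i < d) gauss q n i) * #|codes L n k| * Q ^ (d + k - 2))%N.
Proof.
have Q_gt1 : (1 < Q)%N := finNzRing_gt1 K.
have [/andP[k_gt0 le_kn] /andP[d_gt1 le_dn]] := (k_bounds, d_bounds).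
have d_gt0 : (0 < d <= n)%N by rewrite ltnW.
have n_gt0 : (0 < n)%N by lia.
rewrite card_codes -(leq_pmul2r (ltnW Q_gt1)).
set b := #|bad_codes L n k d|; set S := (\sum_(i < d) _)%N.
have ball : (#|[set x : 'rV[K]_n | (rk_weight x <= d - 1)%N]| - 1 <= S * Q ^ (d - 1))%N.
  apply: leq_trans (leq_subr _ _) _; apply: leq_trans (card_rk_ball_le_sum _ _ _) _.
  rewrite subn1 prednK ?(ltnW d_gt1) // big_distrl; apply: leq_sum => i _.
  rewrite leq_mul2l; apply/orP; right.
  apply: (@leq_trans (\prod_(j < i) Q)%N).
    by apply: leq_prod => j _; rewrite card_finvect leq_subr.
  rewrite prod_nat_const card_ord leq_exp2l //.
  by have := ltn_ord i; lia.
have bQ : (b * Q <= 2 * (S * Q ^ (d - 1) * gauss Q (n - 1) (k - 1)))%N.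
  apply: leq_trans (leq_mul (leqnn 2) (leq_trans (card_bad_codes_le L k_gt0 n_gt0 d_gt0) _)).
    by rewrite mulnCA leq_mul2l -{1}(expn1 Q) -{2}(expn1 Q) half_le_expB1 ?orbT.
  by rewrite leq_mul2r ball orbT.
have gQ : (Q ^ n * gauss Q (n - 1) (k - 1) <= 2 * (gauss Q n k * Q ^ k))%N.
  apply: leq_trans (leq_mul (half_le_expB1 n_gt0) (leqnn _)) _.
  rewrite -mulnA leq_mul2l /= -{1}(subnK n_gt0) addn1 -gauss_absorb // -addn1.
  by rewrite !addn1 -(addn1 (n - 1)) -(addn1 (k - 1)) !subnK // leq_mul2l leq_subr orbT.
rewrite mulnAC; apply: leq_trans (leq_mul bQ (leqnn _)) _.
have -> : (2 * (S * Q ^ (d - 1) * gauss Q (n - 1) (k - 1)) * Q ^ n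
  = 2 * (S * Q ^ (d - 1)) * (Q ^ n * gauss Q (n - 1) (k - 1)))%N by ring.
apply: leq_trans (leq_mul (leqnn _) gQ) _.
have E : (Q ^ (d + k - 2) * Q = Q ^ (d - 1) * Q ^ k)%N.
  by rewrite -expnSr -expnD; congr expn; lia.
by rewrite -[in leqRHS]mulnA E; apply: eq_leq; ring.
Qed.
End DensityBounds.

(** * Bounds for every m and order of growth *)

Theorem corollary5p4 (R : realType) (q n k d : nat) (F : finFieldType)
    (card_F : #|F| = q) (n_ge2 : (2 <= n)%N)
    (k_bounds : (1 <= k <= n)%N) (d_bounds : (2 <= d <= n)%N)
    (dk_le_n : (d + k - 2 <= n)%N) :
  (forall (m : nat) (L : fieldExtType F),
     (n <= m)%N -> \dim {:L} = m ->
     ((qbinom (finvect_type L) n k)%:R)^-1 *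
       (Lambda (finvect_type L) n (d - 1) k)%:~R <= bad_density R L n k d
     /\ bad_density R L n k d <=
       (q%:R ^+ (m * k) - 1) / ((q%:R ^+ m - 1) * (q%:R ^+ (m * n) - 1)) *
       ((rk_ball_size F m n (d - 1))%:~R - 1))
  /\
  (forall L : nat -> fieldExtType F,
     (forall m : nat, (n <= m)%N -> \dim {:L m} = m) ->
     Theta (fun m => (n <= m)%N)
       (fun m => q%:R ^ (m%:Z * (d%:Z + k%:Z - 2 - n%:Z)))
       (fun m => bad_density R (L m) n k d)).
Proof.
have /andP[k_gt0 le_kn] := k_bounds; have /andP[d_gt1 le_dn] := d_bounds.
have d_bounds1 : (0 < d <= n)%N by rewrite ltnW.
have n_gt0 : (0 < n)%N := ltnW n_ge2.
have q_gt1 : (1 < q)%N by rewrite -card_F finNzRing_gt1.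
have codes_gt0 (L : fieldExtType F) : (0 : R) < #|codes L n k|%:R.
  by rewrite ltr0n card_codes gauss_gt0.
split=> [m L le_nm dim_L | L dim_L].
  set Q := #|finvect_type L|.
  have QE e : (q%:R : R) ^+ (m * e) = Q%:R ^+ e.
    by rewrite /Q card_finvect dim_L card_F natrX exprM.
  have QE1 : (q%:R : R) ^+ m = Q%:R by rewrite -[m]muln1 QE.
  split.
    rewrite /bad_density mulrC ler_pM2r ?invr_gt0 ?codes_gt0 //.
    by rewrite -[leRHS]/((Posz _)%:~R) ler_int Lambda_le_card_bad_codes.
  have Q_gt1 : (1 < Q)%N := finNzRing_gt1 _.
  have expB1_gt0 e : (0 < e)%N -> (0 : R) < Q%:R ^+ e - 1.
    by move=> e_gt0; rewrite subr_gt0 exprn_egt1 ?ltr1n // -lt0n.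
  have QB1_gt0 : (0 : R) < Q%:R - 1 by rewrite subr_gt0 ltr1n.
  rewrite /bad_density !QE QE1 ler_pdivrMr ?codes_gt0 //.
  set B := [set x : 'rV[finvect_type L]_n | (rk_weight x <= d - 1)%N].
  set ball := rk_ball_size _ _ _ _.
  have ballR : (#|B| - 1)%N%:R <= (ball%:~R - 1 : R).
    rewrite natrB; last by apply/card_gt0P; exists 0; rewrite inE rk_weight0.
    rewrite lerB // -[leLHS]/((Posz _)%:~R) ler_int /ball -dim_L.
    by apply: card_rk_ball_le; rewrite dim_L; lia.
  have := card_bad_codes_le L k_gt0 n_gt0 d_bounds1.
  rewrite -/B -/Q -(ler_nat R) !natrM natrB ?(ltnW Q_gt1) // => bad_le.
  have := gauss_absorb Q_gt1 (n - 1) (k - 1).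
  rewrite subn1 prednK // subn1 prednK // => /(congr1 (fun a => a%:R : R)).
  rewrite !natrM !natrB ?expn_gt0 ?(ltnW Q_gt1) // !natrX -!subn1 => absorb.
  rewrite card_codes -/Q.
  (* Absorption turns the claimed bound, multiplied by the number of codes, into the double-counting
     bound on bad codes. *)
  have -> : (Q%:R ^+ k - 1) / ((Q%:R - 1) * (Q%:R ^+ n - 1)) * (ball%:~R - 1)
      * (gauss Q n k)%:R
    = (ball%:~R - 1) * (gauss Q (n - 1) (k - 1))%:R / (Q%:R - 1) :> R.
    have QnB1_gt0 := expB1_gt0 _ n_gt0.
    transitivity ((ball%:~R - 1) * ((gauss Q n k)%:R * (Q%:R ^+ k - 1))
                  / ((Q%:R - 1) * (Q%:R ^+ n - 1)) : R).
      by field; rewrite !lt0r_neq0.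
    by rewrite absorb; field; rewrite !lt0r_neq0.
  rewrite ler_pdivlMr //; apply: le_trans bad_le _.
  by rewrite ler_wpM2r.
pose S := (\sum_(i < d) gauss q n i)%N.
have S_gt0 : (0 < S)%N.
  by rewrite /S -(prednK (ltnW d_gt1)) big_ord_recl addn_gt0 gauss_gt0.
(* The constants are those of the two density estimates; they are free of m, and every m >= n is
   admissible. *)
exists (2 ^ (2 * k))%:R^-1, (4 * S)%N%:R, n; split=> //.
- by rewrite invr_gt0 ltr0n expn_gt0.
- by rewrite ltr0n muln_gt0.
move=> m le_nm _; set Q := #|finvect_type (L m)|.
have Q_gt0 : (0 : R) < Q%:R by rewrite ltr0n ltnW // finNzRing_gt1.
have -> : q%:R ^ (m%:Z * (d%:Z + k%:Z - 2 - n%:Z)) = Q%:R ^+ (d + k - 2) / Q%:R ^+ n :> R.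
  have -> : m%:Z * (d%:Z + k%:Z - 2 - n%:Z) = (m * (d + k - 2))%N%:Z - (m * n)%N%:Z.
    have -> : d%:Z + k%:Z - 2 - n%:Z = (d + k - 2)%N%:Z - n%:Z by lia.
    by rewrite mulrBr !PoszM.
  rewrite expfzDr ?pnatr_eq0 -?lt0n ?(ltnW q_gt1) // -exprnP -exprnN.
  by rewrite /Q card_finvect dim_L // card_F natrX -!exprM.
have lower := card_codes_le_bad_codes (L m) k_bounds d_bounds dk_le_n.
have upper := card_bad_codes_le_codes (L m) k_bounds d_bounds.
move: lower upper; rewrite card_F -/S -/Q -!(ler_nat R) !natrM !natrX => lower upper.
rewrite /bad_density.
split.
- by rewrite !mulr_ge0 ?invr_ge0 ?exprn_ge0 ?ler0n.
- rewrite ler_pdivlMr // -!mulrA ler_pdivrMl ?exprn_gt0 ?ltr0n //.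
  by rewrite mulrCA ler_pdivrMl ?exprn_gt0 // mulrC [leRHS]mulrC.
- by rewrite ler_pdivrMr // mulrA mulrAC ler_pdivlMr ?exprn_gt0 // mulrAC.
Qed.
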